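(* Let $(N_1,C_1)$ and $(N_2,C_2)$ be coherent nets and $E$ a Presburger formula with free variables in $P_1\cup P_2$, and suppose $(N_1,C_1)\preceq_E(N_2,C_2)$. Then for every pair of markings $m_1\in\mathbb N^{P_1}$, $m_2\in\mathbb N^{P_2}$ such that $m_1\models C_1$, $m_1\equiv_E m_2$ and $m_2\models C_2$, we have $(N_1,m_1)\sqsubseteq_E(N_2,m_2)$.
   Context: A labeled Petri net $N=(P,T,\mathrm{Pre},\mathrm{Post})$ consists of a finite set of places $P$, a finite set of transitions $T$ disjoint from $P$, functions $\mathrm{Pre},\mathrm{Post}:T\to(P\to\mathbb N)$, and a labeling $l:T\to\Sigma\cup\{\tau\}$, where $\Sigma$ is an alphabet and $\tau\notin\Sigma$ is the silent action. A marking is a map $m:P\to\mathbb N$. Transition $t$ is enabled at $m$ if $m(p)\ge\mathrm{Pre}(t,p)$ for all $p$, and then $m\xrightarrow{t}m'$ with $m'=m-\mathrm{Pre}(t)+\mathrm{Post}(t)$. For $\varrho=t_1\cdots t_n\in T^*$, $m\xRightarrow{\varrho}m'$ means there are markings $m=m_0,\dots,m_n=m'$ with $m_i\xrightarrow{t_{i+1}}m_{i+1}$. Extend $l$ to sequences by erasing silent transitions ($l(\epsilon)=\epsilon$, $l(\varrho t)=l(\varrho)$ if $l(t)=\tau$, else $l(\varrho)l(t)$). For $\sigma\in\Sigma^*$, $m\xRightarrow{\sigma}m'$ means there is $\varrho$ with $m\xRightarrow{\varrho}m'$ and $l(\varrho)=\sigma$; in particular $m\xRightarrow{\epsilon}m'$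 means $m'$ is reached by a (possibly empty) sequence of silent transitions. Define $m\overset{\sigma}{\twoheadrightarrow}m'$ by: $m\overset{\epsilon}{\twoheadrightarrow}m'$ iff $m'=m$; and for $\sigma\in\Sigma^*$, $a\in\Sigma$, $m\overset{\sigma a}{\twoheadrightarrow}m'$ iff there exist a marking $m''$ and a transition $t$ with $l(t)=a$ and $m\xRightarrow{\sigma}m''\xrightarrow{t}m'$. A coherency constraint $C$ for $N$ is a Presburger formula over the places of $N$, viewed as a set of markings. $(N,C)$ is a coherent net if for every $m\models C$, $\sigma\in\Sigma^*$ and $m'$ with $m\xRightarrow{\sigma}m'$, there exists $m''\models C$ with $m\overset{\sigma}{\twoheadrightarrow}m''$ and $m''\xRightarrow{\epsilon}m'$. For nets $N_1,N_2$ with place sets $P_1,P_2$ (possibly sharing places), a Presburger formula $E$ with free variables in $P_1\cup P_2$, and markings $m_1\in\mathbb N^{P_1}$, $m_2\in\mathbb N^{P_2}$: $m_1\equiv_E m_2$ means $m_1,m_2$ agree on $P_1\cap P_2$ and the assignment $m_1\cup m_2$ satisfies $E$ over $\mathbb N$. Write $m_1\langle C_1EC_2\rangle m_2$ for ($m_1\models C_1$ and $m_1\equiv_E m_2$ and $m_2\models C_2$). $(N_1,C_1)\preceq_E(N_2,C_2)$ (parametric $E$-abstraction) means: (S1) for every $m_1\models C_1$ there is $m_2$ with $m_1\langle C_1EC_2\rangle m_2$; (S2) for all $m_1\xRightarrow{\epsilon}m_1'$ in $N_1$ and all $m_2$, $m_1\equiv_E m_2$ implies $m_1'\equiv_E m_2$;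 (S3) for all $\sigma\in\Sigma^*$, all $m_1\xRightarrow{\sigma}m_1'$ in $N_1$ and all $m_2,m_2'$, if $m_1\langle C_1EC_2\rangle m_2$ and $m_1'\equiv_E m_2'$ then $m_2\xRightarrow{\sigma}m_2'$ in $N_2$. $(N_1,m_1)\sqsubseteq_E(N_2,m_2)$ ($E$-abstraction of marked nets) means: (A1) $m_1\equiv_E m_2$; (A2) for every $(N_1,m_1)\xRightarrow{\sigma}(N_1,m_1')$ there is at least one $m_2'$ with $m_1'\equiv_E m_2'$, and for every $m_2'$ with $m_1'\equiv_E m_2'$ we have $(N_2,m_2)\xRightarrow{\sigma}(N_2,m_2')$. *)

(* Defs.v *)
From HB Require Import structures.
From mathcomp Require Import all_boot finmap.

Set Implicit Arguments.
Unset Strict Implicit.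
Unset Printing Implicit Defensive.

Local Open Scope fset_scope.

(* [formula X] is the type of Presburger formulas whose free variables lie in
   [X].  Under a quantifier the bound variable is [None : option X], and [Some]
   embeds the variables of the enclosing scope. *)
Inductive term (X : Type) : Type :=
  | TVar of X
  | TZero
  | TOne
  | TAdd of term X & term X.

Inductive formula (X : Type) : Type :=
  | FEq of term X & term X
  | FLe of term X & term X
  | FNot of formula X
  | FAnd of formula X & formula X
  | FOr of formula X & formula X
  | FExists of formula (option X)
  | FForall of formula (option X).

Fixpoint eval_term (X : Type) (rho : X -> nat) (t : term X) : nat :=
  match t with
  | TVar x => rho x
  | TZero => 0
  | TOne => 1
  | TAdd t1 t2 => (eval_term rho t1 + eval_term rho t2)%N
  end.

Definition extend_env (X : Type) (rho : X -> nat) (n : nat) : option X -> nat :=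
  fun o => if o is Some x then rho x else n.

Fixpoint sat (X : Type) (rho : X -> nat) (F : formula X) {struct F} : Prop :=
  match F with
  | FEq t1 t2 => eval_term rho t1 = eval_term rho t2
  | FLe t1 t2 => (eval_term rho t1 <= eval_term rho t2)%N
  | FNot F1 => ~ sat rho F1
  | FAnd F1 F2 => sat rho F1 /\ sat rho F2
  | FOr F1 F2 => sat rho F1 \/ sat rho F2
  | FExists F1 => exists n : nat, sat (extend_env rho n) F1
  | FForall F1 => forall n : nat, sat (extend_env rho n) F1
  end.

(* Places are drawn from a common universe [V], so that two nets can share
   some of them; transitions live in a type of their own, hence are disjoint
   from the places.  The label [None] is the silent action. *)
Record net (V : choiceType) (Sigma : Type) := Net {
  places : {fset V};
  trans : finType;
  pre : trans -> places -> nat;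
  post : trans -> places -> nat;
  label : trans -> option Sigma
}.

Definition marking (V : choiceType) (Sigma : Type) (N : net V Sigma) : Type :=
  {ffun places N -> nat}.

Section Semantics.

Variables (V : choiceType) (Sigma : Type) (N : net V Sigma).

Implicit Types (m : marking N) (t : trans N).

Definition enabled m t : Prop := forall p : places N, (pre t p <= m p)%N.

(* The truncated subtraction is exact, because [t] is enabled at [m]. *)
Definition fires m t m' : Prop :=
  enabled m t /\ m' = [ffun p => (m p - pre t p + post t p)%N].

Fixpoint fires_seq m (r : seq (trans N)) m' : Prop :=
  if r is t :: r' then exists m'', fires m t m'' /\ fires_seq m'' r' m'
  else m = m'.

Definition label_seq (r : seq (trans N)) : seq Sigma := pmap (@label _ _ N) r.

Definition weak_step m (s : seq Sigma) m' : Prop :=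
  exists r : seq (trans N), fires_seq m r m' /\ label_seq r = s.

Inductive tight_step m : seq Sigma -> marking N -> Prop :=
  | TightNil : tight_step m [::] m
  | TightRcons (s : seq Sigma) (a : Sigma) m'' t m' :
      label t = Some a -> weak_step m s m'' -> fires m'' t m' ->
      tight_step m (rcons s a) m'.

Definition models m (C : formula (places N)) : Prop := sat m C.

Definition coherent (C : formula (places N)) : Prop :=
  forall m (s : seq Sigma) m',
    models m C -> weak_step m s m' ->
    exists m'', [/\ models m'' C, tight_step m s m'' & weak_step m'' [::] m'].

End Semantics.

Section Abstraction.

Variables (V : choiceType) (Sigma : Type) (N1 N2 : net V Sigma).

Definition compatible (m1 : marking N1) (m2 : marking N2) : Prop :=
  forall (p1 : places N1) (p2 : places N2), val p1 = val p2 -> m1 p1 = m2 p2.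

(* The final [0] is never reached: [x] belongs to one of the two place sets. *)
Definition union_marking (m1 : marking N1) (m2 : marking N2)
    (x : places N1 `|` places N2) : nat :=
  if insub (val x) is Some p1 then m1 p1
  else if insub (val x) is Some p2 then m2 p2 else 0.

Variables (C1 : formula (places N1)) (E : formula (places N1 `|` places N2)).
Variable C2 : formula (places N2).

Definition equivE (m1 : marking N1) (m2 : marking N2) : Prop :=
  compatible m1 m2 /\ sat (union_marking m1 m2) E.

Definition equivCEC (m1 : marking N1) (m2 : marking N2) : Prop :=
  [/\ models m1 C1, equivE m1 m2 & models m2 C2].

Definition parametric_abstraction : Prop :=
  [/\ forall m1 : marking N1,
        models m1 C1 -> exists m2 : marking N2, equivCEC m1 m2,
      forall (m1 m1' : marking N1) (m2 : marking N2),
        weak_step m1 [::] m1' -> equivE m1 m2 -> equivE m1' m2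
    & forall (s : seq Sigma) (m1 m1' : marking N1) (m2 m2' : marking N2),
        weak_step m1 s m1' -> equivCEC m1 m2 -> equivE m1' m2' ->
        weak_step m2 s m2'].

Definition marked_abstraction (m1 : marking N1) (m2 : marking N2) : Prop :=
  equivE m1 m2 /\
  forall (s : seq Sigma) (m1' : marking N1), weak_step m1 s m1' ->
    (exists m2' : marking N2, equivE m1' m2') /\
    (forall m2' : marking N2, equivE m1' m2' -> weak_step m2 s m2').

End Abstraction.

(* Main.v *)
Require Import Defs.
From HB Require Import structures.
From mathcomp Require Import all_boot finmap.

Local Open Scope fset_scope.

(** Simulation by [N2] is exactly (S3), whose source pair satisfies both constraints. The real issue
    is that some marking must be equivalent to [m1']: (S1) cannot be applied there, since [m1'] may
    violate [C1]. Coherence of [C1] supplies a marking of [C1] from which [m1'] is reached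
    silently. *)

Theorem theorem2 (V : choiceType) (Sigma : Type) (N1 N2 : net V Sigma)
    (C1 : formula (places N1)) (C2 : formula (places N2))
    (E : formula (places N1 `|` places N2))
    (coh1 : coherent C1) (coh2 : coherent C2)
    (abs12 : parametric_abstraction C1 E C2)
    (m1 : marking N1) (m2 : marking N2)
    (hC1 : models m1 C1) (hE : equivE E m1 m2) (hC2 : models m2 C2) :
  marked_abstraction E m1 m2.
Proof.
have [S1 S2 S3] := abs12.
split=> // s m1' step1; split; last first.
  (* The final [split] builds [equivCEC] for [m1] and [m2] from [hC1], [hE] and [hC2]. *)
  by move=> m2' hE'; apply: S3 step1 _ hE'; split.
(* Coherence factors the run through a marking of [C1], where (S1) applies;
   (S2) carries the resulting equivalence along the silent suffix. *)
have [m1'' [hC1'' _ silent]] := coh1 _ _ _ hC1 step1.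
have [m2' [_ hE' _]] := S1 _ hC1''.
by exists m2'; apply: S2 silent hE'.
Qed.
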